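(* Let $X$ be a real normed space and let $C\subseteq X$ be a convex cone with a finite basis $\{e_1,\dots,e_n\}$. If $\varphi:C\rightarrow c(C)$ is a sublinear correspondence, then $$\mathfrak{h}_1(M_{\widehat{\varphi}},\{\mathbb{I}\})\geq\sup\{\mathfrak{h}(\varphi(x),\{x\}):x\in C,\ \|x\|=1\},$$ where $\widehat{\varphi}$ is the linear correspondence defined by $\widehat{\varphi}(x)=\sum_{j=1}^n\lambda_j\,\overline{co}(\varphi(e_j))$ for $x=\sum_{j=1}^n\lambda_je_j\in C$.
   Context: A subset $C$ of a real normed space $X$ is a cone if $tC\subseteq C$ for every $t>0$. A linearly independent set $E$ is a basis of the cone $C$ if $C$ is exactly the set of all finite combinations $\lambda_1e_1+\dots+\lambda_ne_n$ with $e_i\in E$ and $\lambda_i\ge 0$. $c(C)$ is the set of all nonempty compact subsets of $C$; $\varphi:C\to c(C)$ denotes a correspondence (set-valued map) with values $\varphi(x)\in c(C)$. It is sublinear if $\varphi(x+y)\subseteq\varphi(x)+\varphi(y)$ and $\varphi(\lambda x)=\lambda\varphi(x)$ for all $x,y\in C$, $\lambda>0$; linear if additionally $\varphi(x+y)=\varphi(x)+\varphi(y)$. $\overline{co}$ denotes the closed convex hull (taken in the completion of the ambient normed space; for values in $c(C)$ with $C$ finitely generated it is a compact convex subset of $C$). The linear isomorphism $l:C-C\to\mathbb{R}^n$ is $l\left(\sum_{j=1}^n\lambda_je_j\right)=(\lambda_1,\dots,\lambda_n)^T$, and for a correspondence $\psi:C\twoheadrightarrow C$, $M_\psi:=l(\psi(e_1))\times\dots\times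 l(\psi(e_n))$ is regarded as the set of all real $n\times n$ matrices whose $j$-th column lies in $l(\psi(e_j))$ for each $j$. $\mathfrak{h}$ is the Hausdorff metric on nonempty compact sets, $\mathfrak{h}(A,B)=\max\{\sup_{a\in A}d(a,B),\sup_{b\in B}d(b,A)\}$, for the norm of $X$. The space of real $n\times n$ matrices carries the norm $$\|A\|=\sup\left\{\left\|\sum_{i=1}^n\left(\sum_{j=1}^n\lambda_ja_{ij}\right)e_i\right\|:\ \sum_{j=1}^n\lambda_je_j\in C,\ \left\|\sum_{j=1}^n\lambda_je_j\right\|=1\right\},\quad A=[a_{ij}],$$ $\mathfrak{h}_1$ is the Hausdorff metric derived from this matrix norm, and $\mathbb{I}$ is the unit (identity) matrix. *)

(* Defs.v *)
From HB Require Import structures.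
From mathcomp Require Import all_boot all_order all_algebra.
From mathcomp Require Import all_classical all_reals all_analysis.
Set Implicit Arguments.
Unset Strict Implicit.
Unset Printing Implicit Defensive.
Import Order.TTheory GRing.Theory Num.Theory.
Import numFieldNormedType.Exports.
Local Open Scope classical_set_scope.
Local Open Scope ring_scope.

Definition set_add (R : realType) (X : normedModType R) (A B : set X) : set X :=
  [set a + b | a in A & b in B].

Definition set_scale (R : realType) (X : normedModType R) (t : R) (A : set X) :
  set X := [set t *: a | a in A].

Definition set_sum (R : realType) (X : normedModType R) (n : nat)
    (A : 'I_n -> set X) : set X :=
  [set x | exists a : 'I_n -> X, (forall j, A j (a j)) /\ x = \sum_j a j].

Definition is_cone (R : realType) (X : normedModType R) (C : set X) : Prop :=
  forall t : R, 0 < t -> set_scale t C `<=` C.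

Definition lin_indep (R : realType) (X : normedModType R) (E : set X) : Prop :=
  forall s : seq X, uniq s -> [set` s] `<=` E ->
  forall c : X -> R, \sum_(x <- s) c x *: x = 0 -> forall x, x \in s -> c x = 0.

Definition cone_span (R : realType) (X : normedModType R) (E : set X) : set X :=
  [set x | exists (s : seq X) (c : X -> R),
     [/\ [set` s] `<=` E, forall y, 0 <= c y & x = \sum_(y <- s) c y *: y]].

Definition cone_basis (R : realType) (X : normedModType R) (E C : set X) : Prop :=
  lin_indep E /\ C = cone_span E.

(* A correspondence C -> c(C) is represented by a map on all of X, of which
   only the values on C are constrained. *)
Definition compact_corr (R : realType) (X : normedModType R) (C : set X)
    (phi : X -> set X) : Prop :=
  forall x, C x -> [/\ phi x !=set0, compact (phi x) & phi x `<=` C].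

Definition sublinear_corr (R : realType) (X : normedModType R) (C : set X)
    (phi : X -> set X) : Prop :=
  (forall x y, C x -> C y -> phi (x + y) `<=` set_add (phi x) (phi y)) /\
  (forall (t : R) x, 0 < t -> C x -> phi (t *: x) = set_scale t (phi x)).

(* The hull is taken in X and not in its completion: the convex hull of a
   compact subset of a finitely generated cone is already compact, so that both
   closures coincide on the values at which the hull is used. *)
Definition closed_convex_hull (R : realType) (X : normedModType R) (A : set X) :
  set X := smallest [set B : set X | closed B /\ convex_set B] A.

(* The isomorphism l : C - C -> R^n, extended by 0 outside the span of e. *)
Definition coord_iso (R : realType) (X : normedModType R) (n : nat)
    (e : 'I_n -> X) (x : X) : 'cV[R]_n :=
  xget 0 [set v : 'cV[R]_n | x = \sum_j v j 0 *: e j].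

Definition hat_corr (R : realType) (X : normedModType R) (n : nat)
    (e : 'I_n -> X) (phi : X -> set X) (x : X) : set X :=
  set_sum (fun j => set_scale (coord_iso e x j 0) (closed_convex_hull (phi (e j)))).

Definition corr_mx (R : realType) (X : normedModType R) (n : nat)
    (e : 'I_n -> X) (psi : X -> set X) : set 'M[R]_n :=
  [set A | forall j, (coord_iso e @` psi (e j)) (col j A)].

Definition cone_mx_norm (R : realType) (X : normedModType R) (n : nat)
    (C : set X) (e : 'I_n -> X) (A : 'M[R]_n) : R :=
  sup [set r | exists lam : 'I_n -> R,
    [/\ C (\sum_j lam j *: e j), `|\sum_j lam j *: e j| = 1 &
        r = `|\sum_i (\sum_j lam j * A i j) *: e i|]].

Definition dist_to_set (R : realType) (T : Type) (d : T -> T -> R)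
    (a : T) (B : set T) : \bar R := ereal_inf [set (d a b)%:E | b in B].

Definition hausdorff_dist (R : realType) (T : Type) (d : T -> T -> R)
    (A B : set T) : \bar R :=
  maxe (ereal_sup [set dist_to_set d a B | a in A])
       (ereal_sup [set dist_to_set d b A | b in B]).

Definition hausdorff_norm_dist (R : realType) (X : normedModType R) (A B : set X) :
  \bar R := hausdorff_dist (fun x y : X => `|x - y|) A B.

Definition hausdorff_mx_dist (R : realType) (X : normedModType R) (n : nat)
    (C : set X) (e : 'I_n -> X) (A B : set 'M[R]_n) : \bar R :=
  hausdorff_dist (fun M N : 'M[R]_n => cone_mx_norm C e (M - N)) A B.

(* Main.v *)
Require Import Defs.
From HB Require Import structures.
From mathcomp Require Import all_boot all_order all_algebra.
From mathcomp Require Import all_classical all_reals all_analysis.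
Set Implicit Arguments.
Unset Strict Implicit.
Unset Printing Implicit Defensive.
Import Order.TTheory GRing.Theory Num.Theory.
Import numFieldNormedType.Exports.
Local Open Scope classical_set_scope.
Local Open Scope ring_scope.

(** Fix a unit vector x of the cone with coordinates lam. Subadditivity,
    iterated along the basis, puts every point b of phi x in the form
    \sum_j lam j *: a j with a j in phi (e j). The columns of coordinates of
    the points a j form a matrix A; since phi (e j) is contained in its closed
    convex hull, which is the value of hat_corr at e j, the matrix A belongs to
    corr_mx e (hat_corr e phi), and A maps the coordinates of x to those of b
    ([sublinear_corr_mx]). Hence b - x is the value of A - 1 at x, so that
    `|b - x| is at most the operator norm of A - 1 ([le_cone_mx_norm]), and the
    distance from A to the identity is one of the terms in the supremum that
    defines the Hausdorff distance from the set of matrices. Against a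
    singleton, the Hausdorff distance from phi x to x is the largest `|b - x|
    ([hausdorff_dist1_le]), which gives the bound for each x.

    Two points need topology. The operator norm is a supremum in the reals, so
    it dominates its terms only once the set is known to be bounded: the
    coordinates of a unit vector are bounded because the norm attains a
    positive minimum on the compact unit sphere of coordinate vectors
    ([free_family_coord_bound]). And coordinates of x may vanish, while
    homogeneity is only assumed for positive scalars: at scalar 0 it is
    replaced by phi 0 being the zero singleton, which holds since phi 0 is
    bounded and stable under positive scaling ([sublinear_corr0]). *)

(** * Coordinates in a free family *)

Definition free_family (R : pzRingType) (V : lmodType R) (n : nat)
    (e : 'I_n -> V) : Prop :=
  forall c : 'I_n -> R, \sum_j c j *: e j = 0 -> forall j, c j = 0.

(** Linear independence of the range speaks of coefficients indexed by vectors;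
    injectivity of e turns them into coefficients indexed by 'I_n. *)
Lemma lin_indep_free_family (R : realType) (X : normedModType R) (n : nat)
    (e : 'I_n -> X) :
  injective e -> lin_indep (range e) -> free_family e.
Proof.
move=> e_inj e_indep c c0 j.
(* For injective e this is c read off at the index of y. *)
pose c' y := \sum_(k | e k == y) c k.
have c'e k : c' (e k) = c k.
  by rewrite /c' (big_pred1 k)// => i; rewrite (inj_eq e_inj).
rewrite -c'e; apply: (e_indep (map e (enum 'I_n))).
- by rewrite map_inj_uniq ?enum_uniq.
- by move=> _ /= /mapP[k _ ->]; exists k.
- rewrite big_map big_enum /= -[RHS]c0.
  by apply: eq_bigr => k _; rewrite c'e.
- by rewrite map_f ?mem_enum.
Qed.

Lemma sum_delta_scale (R : pzRingType) (V : lmodType R) (n : nat)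
    (e : 'I_n -> V) (j : 'I_n) :
  \sum_i (i == j)%:R *: e i = e j.
Proof.
rewrite (bigD1 j)//= eqxx scale1r big1 ?addr0// => i /negPf ->.
by rewrite scale0r.
Qed.

Lemma coord_iso_sum (R : realType) (X : normedModType R) (n : nat)
    (e : 'I_n -> X) (v : 'cV[R]_n) :
  free_family e -> coord_iso e (\sum_j v j 0 *: e j) = v.
Proof.
move=> e_free; rewrite /coord_iso; case: xgetP => [w _ /= wE|/(_ v)]; last by case.
apply/colP => j; apply/esym/eqP; rewrite -subr_eq0; apply/eqP.
apply: (e_free (fun j => v j 0 - w j 0)).
under eq_bigr do rewrite scalerBl.
by rewrite sumrB -wE subrr.
Qed.

(** Finite-dimensional norm equivalence: on the compact unit sphere of 'rV[R]_n
    the continuous function v |-> `|\sum_i v 0 i *: e i| attains its minimum,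
    which is positive because e is free; K is the inverse of that minimum. *)
Lemma free_family_coord_bound (R : realType) (X : normedModType R) (n : nat)
    (e : 'I_n -> X) :
  free_family e ->
  exists2 K : R, 0 <= K &
    forall (c : 'I_n -> R) j, `|c j| <= K * `|\sum_i c i *: e i|.
Proof.
move=> e_free.
pose S := [set v : 'rV[R]_n | `|v| = 1].
pose f (v : 'rV[R]_n) : R := `|\sum_i v 0 i *: e i|.
have fZ t v : f (t *: v) = `|t| * f v.
  rewrite /f -normrZ scaler_sumr; congr `|_|.
  by apply: eq_bigr => i _; rewrite mxE scalerA.
have entry_le (v : 'rV[R]_n) j : `|v 0 j| <= `|v|.
  rewrite [leRHS]/Num.norm /= mx_normrE.
  by apply/bigmax_geP; right => /=; exists (0, j).
have f_cont : continuous f.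
  move=> v; apply: (@continuous_comp _ _ _ (fun w : 'rV[R]_n => \sum_i w 0 i *: e i)
    (fun y : X => `|y|)); last exact: norm_continuous.
  move: v; apply: continuous_big => [|i _ v]; first exact: add_continuous.
  exact: (continuous_comp (@coord_continuous _ _ _ 0 i v) (@scalel_continuous _ _ (e i) _)).
have S_compact : compact S.
  apply: bounded_closed_compact.
    exists 1; split=> // M M1 v /= ->; exact: ltW.
  rewrite (_ : S = (fun v : 'rV[R]_n => `|v|) @^-1` [set 1])//.
  apply: preimage_closed; last exact: closed_eq.
  by move=> v _; exact: norm_continuous.
have bound_of_min m : 0 < m -> (forall v, S v -> m <= f v) ->
    exists2 K : R, 0 <= K &
    forall (c : 'I_n -> R) j, `|c j| <= K * `|\sum_i c i *: e i|.
  move=> m0 mS; exists m^-1; first by rewrite invr_ge0 ltW.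
  move=> c j; pose v : 'rV[R]_n := \row_i c i.
  have -> : `|\sum_i c i *: e i| = f v.
    by congr `|_|; apply: eq_bigr => i _; rewrite mxE.
  have -> : c j = v 0 j by rewrite mxE.
  apply: le_trans (entry_le v j) _.
  rewrite mulrC ler_pdivlMr//.
  have [->|v0] := eqVneq v 0; first by rewrite normr0 mul0r normr_ge0.
  have nv : 0 < `|v| by rewrite normr_gt0.
  have := mS (`|v|^-1 *: v); rewrite fZ normfV normr_id mulrC ler_pdivlMr// mulrC.
  by apply; rewrite /S /= normrZ normfV normr_id mulVf// gt_eqF.
(* The sphere is empty exactly when n = 0, where the condition on the minimum is void. *)
have [S0|S0] := eqVneq S set0.
  by apply: (bound_of_min 1) => // v; rewrite S0.
have [|c cS cmin] := compact_EVT_min _ S_compact (continuous_subspaceT f_cont).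
  exact/set0P.
apply: (bound_of_min (f c)) => [|v /mem_set/cmin//].
rewrite normr_gt0; apply/eqP => /(e_free (fun i => c 0 i)) c0.
move: cS; rewrite inE /S /= (_ : c = 0); last by apply/rowP => i; rewrite c0 mxE.
by rewrite normr0 => /esym/eqP; rewrite oner_eq0.
Qed.

(** [sup] is 0 on unbounded sets, so the content here is that the set whose
    supremum defines [cone_mx_norm] is bounded; this follows from the bound on
    the coordinates of a unit vector. *)
Lemma le_cone_mx_norm (R : realType) (X : normedModType R) (n : nat)
    (C : set X) (e : 'I_n -> X) (A : 'M[R]_n) (lam : 'I_n -> R) :
  free_family e ->
  C (\sum_j lam j *: e j) -> `|\sum_j lam j *: e j| = 1 ->
  `|\sum_i (\sum_j lam j * A i j) *: e i| <= cone_mx_norm C e A.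
Proof.
move=> e_free Clam lam1; apply: ub_le_sup; last by exists lam.
have [K K0 HK] := free_family_coord_bound e_free.
exists (\sum_i (\sum_j K * `|A i j|) * `|e i|) => _ [mu [_ mu1 ->]].
apply: le_trans (ler_norm_sum _ _ _) _; apply: ler_sum => i _.
rewrite normrZ ler_wpM2r//; apply: le_trans (ler_norm_sum _ _ _) _.
apply: ler_sum => j _; rewrite normrM ler_wpM2r//.
by have := HK mu j; rewrite mu1 mulr1.
Qed.

(** * Convex cones with a finite basis *)

(** A combination of repeated vectors of the range is regrouped by index. *)
Lemma cone_span_range (R : realType) (X : normedModType R) (n : nat)
    (e : 'I_n -> X) (x : X) :
  cone_span (range e) x ->
  exists2 c : 'I_n -> R, forall j, 0 <= c j & x = \sum_j c j *: e j.
Proof.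
move=> [s [c [sE c_ge0 ->]]]; elim: s sE => [_|y s IHs sE].
  by exists (fun=> 0) => //; rewrite big_nil big1// => j _; rewrite scale0r.
have [|d d_ge0 dE] := IHs; first by move=> z zs; apply: sE; rewrite /= inE zs orbT.
have [k _ yE] : range e y by apply: sE; rewrite /= inE eqxx.
exists (fun j => (if j == k then c y else 0) + d j).
  by move=> j; rewrite addr_ge0//; case: ifP.
rewrite big_cons dE; under [RHS]eq_bigr do rewrite scalerDl.
rewrite big_split/=; congr (_ + _).
rewrite (bigD1 k)//= eqxx yE big1 ?addr0// => j /negPf ->.
by rewrite scale0r.
Qed.

Lemma sub_cone_span (R : realType) (X : normedModType R) (E : set X) (x : X) :
  E x -> cone_span E x.
Proof.
move=> Ex; exists [:: x], (fun=> 1); split=> //.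
  by move=> y /=; rewrite inE => /eqP ->.
by rewrite big_seq1 scale1r.
Qed.

Lemma cone_span0 (R : realType) (X : normedModType R) (E : set X) :
  cone_span E 0.
Proof. by exists [::], (fun=> 0); split=> //; rewrite big_nil. Qed.

(** x + y is twice the midpoint of x and y. *)
Lemma convex_cone_add (R : realType) (X : normedModType R) (C : set X) (x y : X) :
  is_cone C -> convex_set C -> C x -> C y -> C (x + y).
Proof.
move=> C_cone C_convex Cx Cy.
have half_ge0 : 0 <= 2^-1 :> R by rewrite invr_ge0 ler0n.
have half_le1 : 2^-1 <= 1 :> R by rewrite invf_le1 ?ltr0n// ler1n.
have := C_convex x y (Itv01 half_ge0 half_le1) (mem_set Cx) (mem_set Cy).
move=> /set_mem /(imageP (fun z : X => 2 *: z)) /(C_cone 2 (ltr0n _ 2)).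
rewrite /conv/= /unstable.onem scalerDr !scalerA mulrBr mulr1 mulfV ?pnatr_eq0//.
by rewrite (_ : 2 - 1 = 1) ?scale1r// -[2]/(1 + 1) addrK.
Qed.

(** * Sublinear correspondences *)

(** phi 0 = t phi 0 for all t > 0, so a nonzero b in phi 0 would yield points of
    phi 0 of any positive norm, against boundedness of a compact set. *)
Lemma sublinear_corr0 (R : realType) (X : normedModType R) (C : set X)
    (phi : X -> set X) :
  C 0 -> compact_corr C phi -> sublinear_corr C phi -> phi 0 `<=` [set 0].
Proof.
move=> C0 phi_corr [_ phi_scale] b b0 /=.
have [_ /compact_bounded[M [_ Mb]] _] := phi_corr _ C0.
apply: contrapT => /eqP; rewrite -normr_gt0 => b_gt0.
(* This factor scales b to norm `|M| + 2, above the bound `|M| + 1. *)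
have t_gt0 : 0 < (`|M| + 2) / `|b| by rewrite divr_gt0// ltr_wpDl.
have : phi 0 (((`|M| + 2) / `|b|) *: b).
  by rewrite -[0](scaler0 _ ((`|M| + 2) / `|b|)) phi_scale//; exists b.
move=> /(Mb (`|M| + 1)) /=; rewrite (le_lt_trans (ler_norm _)) ?ltrDl// => /(_ isT).
rewrite normrZ gtr0_norm// mulfVK ?gt_eqF// lerD2l.
by rewrite leNgt ltr1n.
Qed.

Lemma sublinear_corr_scale (R : realType) (X : normedModType R) (C : set X)
    (phi : X -> set X) (t : R) (x : X) :
  C 0 -> compact_corr C phi -> sublinear_corr C phi -> 0 <= t -> C x ->
  phi (t *: x) `<=` set_scale t (phi x).
Proof.
move=> C0 phi_corr phi_sublin; rewrite le_eqVlt => /orP[/eqP <-|t_gt0] Cx.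
  rewrite scale0r => b /(sublinear_corr0 C0 phi_corr phi_sublin) ->.
  by have [[a ax] _ _] := phi_corr _ Cx; exists a => //; rewrite scale0r.
by rewrite phi_sublin.2.
Qed.

(** The sum may be empty: the base case is the inclusion of phi 0 in {0}. *)
Lemma sublinear_corr_sum (R : realType) (X : normedModType R) (C : set X)
    (phi : X -> set X) (m : nat) (y : 'I_m -> X) :
  is_cone C -> convex_set C -> C 0 ->
  compact_corr C phi -> sublinear_corr C phi -> (forall j, C (y j)) ->
  phi (\sum_j y j) `<=` set_sum (fun j => phi (y j)).
Proof.
move=> C_cone C_convex C0 phi_corr phi_sublin.
elim: m y => [|m IHm] y Cy b.
  rewrite big_ord0 => /(sublinear_corr0 C0 phi_corr phi_sublin) ->.
  by exists (fun=> 0); split=> [[]|]//; rewrite big_ord0.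
rewrite big_ord_recl => /(phi_sublin.1 _ _ (Cy ord0)) [].
  by elim/big_ind: _ => // u v; exact: convex_cone_add.
move=> a0 a0y [b' /IHm[//|a [ay ->]] <-].
exists (fun j => if unlift ord0 j is Some k then a k else a0); split.
  by move=> j; case: unliftP => [k|] ->.
rewrite big_ord_recl unlift_none; congr (_ + _).
by apply: eq_bigr => k _; rewrite liftK.
Qed.

(** At the basis vector e j all coordinates but the j-th vanish. The vanishing
    ones still contribute 0 times a hull, which is {0} only when that hull is
    inhabited: hence the hypothesis on all the values phi (e k). *)
Lemma hat_corr_basis (R : realType) (X : normedModType R) (n : nat)
    (e : 'I_n -> X) (phi : X -> set X) (j : 'I_n) :
  free_family e -> (forall k, phi (e k) !=set0) ->
  phi (e j) `<=` hat_corr e phi (e j).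
Proof.
move=> e_free phi0 a aj.
have coordE k : coord_iso e (e j) k 0 = (k == j)%:R.
  rewrite -{1}(sum_delta_scale e j).
  rewrite [X in coord_iso e X](_ : _ = \sum_i (delta_mx j 0 : 'cV[R]_n) i 0 *: e i).
    by rewrite coord_iso_sum// mxE eqxx andbT.
  by apply: eq_bigr => i _; rewrite mxE eqxx andbT.
exists (fun k => (k == j)%:R *: a).
split=> [k|]; last by rewrite (sum_delta_scale (fun=> a)).
rewrite coordE; have [->|kj] := eqVneq k j.
  by exists a => //; exact: sub_gen_smallest.
have [b bk] := phi0 k; exists b; first exact: sub_gen_smallest.
by rewrite !scale0r.
Qed.

(** The convexified values only enter through phi (e j) being part of them:
    the matrix A is built from points of the values phi (e j) themselves. *)
Lemma sublinear_corr_mx (R : realType) (X : normedModType R) (C : set X)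
    (n : nat) (e : 'I_n -> X) (phi : X -> set X) (lam : 'I_n -> R) (b : X) :
  is_cone C -> convex_set C -> free_family e -> C = cone_span (range e) ->
  compact_corr C phi -> sublinear_corr C phi ->
  (forall j, 0 <= lam j) -> phi (\sum_j lam j *: e j) b ->
  exists2 A, corr_mx e (hat_corr e phi) A &
    b = \sum_i (\sum_j lam j * A i j) *: e i.
Proof.
move=> C_cone C_convex e_free CE phi_corr phi_sublin lam_ge0 b_phi.
have C0 : C 0 by rewrite CE; exact: cone_span0.
have Ce j : C (e j) by rewrite CE; apply: sub_cone_span; exists j.
have Clam j : C (lam j *: e j).
  have [->|lam0] := eqVneq (lam j) 0; first by rewrite scale0r.
  by apply: (C_cone (lam j)); [rewrite lt_neqAle eq_sym lam0 lam_ge0|exists (e j)].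
have [a a_phi bE] : exists2 a : 'I_n -> X,
    forall j, phi (e j) (a j) & b = \sum_j lam j *: a j.
  have [b' [b'_phi ->]] :=
    sublinear_corr_sum C_cone C_convex C0 phi_corr phi_sublin Clam b_phi.
  have /choice[a aP] j : exists a, phi (e j) a /\ lam j *: a = b' j.
    have [a ? ?] := sublinear_corr_scale C0 phi_corr phi_sublin
      (lam_ge0 j) (Ce j) (b'_phi j).
    by exists a.
  exists a => [j|]; first by have [] := aP j.
  by apply: eq_bigr => j _; have [] := aP j.
have /choice[c aE] j : exists c : 'I_n -> R, a j = \sum_i c i *: e i.
  have [_ _ phiC] := phi_corr _ (Ce j).
  have := phiC _ (a_phi j); rewrite {1}CE => /cone_span_range[c _ cE].
  by exists c.
exists (\matrix_(i, j) c j i).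
  move=> j; exists (a j).
    by apply: hat_corr_basis => // k; have [] := phi_corr _ (Ce k).
  rewrite -[RHS](coord_iso_sum _ e_free) aE; congr coord_iso.
  by apply: eq_bigr => i _; rewrite !mxE.
rewrite bE; under [RHS]eq_bigr do rewrite scaler_suml.
rewrite exchange_big /=; apply: eq_bigr => j _.
by rewrite aE scaler_sumr; apply: eq_bigr => i _; rewrite mxE scalerA.
Qed.

(** * Hausdorff distance to a singleton *)

Lemma le_hausdorff_dist1 (R : realType) (T : Type) (d : T -> T -> R)
    (A : set T) (a b : T) :
  A a -> ((d a b)%:E <= hausdorff_dist d A [set b])%E.
Proof.
move=> Aa; rewrite /hausdorff_dist le_max; apply/orP; left.
apply: ereal_sup_ubound; exists a => //.
by rewrite /dist_to_set image_set1 ereal_inf1.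
Qed.

(** The second half of the Hausdorff distance to a singleton is an infimum of
    the terms whose supremum is the first half, hence is dominated by it as
    soon as A is inhabited. *)
Lemma hausdorff_dist1_le (R : realType) (T : Type) (d : T -> T -> R)
    (A : set T) (b : T) (M : \bar R) :
  (forall x y, d x y = d y x) -> A !=set0 ->
  (forall a, A a -> ((d a b)%:E <= M)%E) -> (hausdorff_dist d A [set b] <= M)%E.
Proof.
move=> dC [a0 Aa0] AM; rewrite /hausdorff_dist ge_max; apply/andP; split.
  apply: ge_ereal_sup => _ [a Aa <-].
  by rewrite /dist_to_set image_set1 ereal_inf1 AM.
apply: ge_ereal_sup => _ [_ -> <-]; apply: le_trans (AM _ Aa0).
by apply: ereal_inf_lbound; exists a0 => //; rewrite dC.
Qed.

(** * The inequality *)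

Theorem corollary3 (R : realType) (X : normedModType R) (C : set X)
    (n : nat) (e : 'I_n -> X) (phi : X -> set X)
    (C_cone : is_cone C) (C_convex : convex_set C)
    (e_inj : injective e) (e_basis : cone_basis (range e) C)
    (phi_corr : compact_corr C phi) (phi_sublin : sublinear_corr C phi) :
  (hausdorff_mx_dist C e (corr_mx e (hat_corr e phi)) [set 1%:M%R] >=
   ereal_sup [set hausdorff_norm_dist (phi x) [set x] |
              x in [set x | C x /\ `|x|%R = 1%R]])%E.
Proof.
have [e_indep CE] := e_basis.
have e_free := lin_indep_free_family e_inj e_indep.
apply: ge_ereal_sup => _ [x [Cx x1] <-].
apply: hausdorff_dist1_le => [u v||b b_phi]; first exact: distrC.
  by have [] := phi_corr _ Cx.
have [lam lam_ge0 xE] : exists2 c : 'I_n -> R,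
    forall j, 0 <= c j & x = \sum_j c j *: e j.
  by apply: cone_span_range; rewrite -CE.
rewrite xE in b_phi.
have [A A_hat bE] :=
  sublinear_corr_mx C_cone C_convex e_free CE phi_corr phi_sublin lam_ge0 b_phi.
apply: le_trans (le_hausdorff_dist1 _ _ A_hat); rewrite lee_fin.
have -> : b - x = \sum_i (\sum_j lam j * (A - 1%:M) i j) *: e i.
  rewrite bE xE -sumrB; apply: eq_bigr => i _; rewrite -scalerBl; congr (_ *: _).
  under [RHS]eq_bigr do rewrite !mxE mulrBr.
  rewrite sumrB; congr (_ - _).
  rewrite (bigD1 i)//= eqxx mulr1 big1 ?addr0// => j; rewrite eq_sym => /negPf ->.
  by rewrite mulr0.
by apply: le_cone_mx_norm; rewrite // -xE.
Qed.
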